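(* Let $n\geqslant 5$, $\alpha\in[0,1)$, and let $G$ be a connected graph of order $n$ with independence number $n-2$. Then $$\lambda_\alpha(G)\geqslant \lambda_\alpha\left(G_2\left(\left\lceil\tfrac{n-3}{2}\right\rceil,\left\lfloor\tfrac{n-3}{2}\right\rfloor\right)\right),$$ with equality if and only if $G\cong G_2\left(\left\lceil\frac{n-3}{2}\right\rceil,\left\lfloor\frac{n-3}{2}\right\rfloor\right)$.
   Context: All graphs are finite, simple and connected. For a graph $G$ with adjacency matrix $A(G)$ and diagonal degree matrix $D(G)$, and $\alpha\in[0,1]$, $A_\alpha(G)=\alpha D(G)+(1-\alpha)A(G)$ and $\lambda_\alpha(G)$ denotes its largest eigenvalue. For nonnegative integers $s,t$ with $s+t=n-3$, $G_2(s,t)$ is the $n$-vertex tree obtained from the path $v_1v_3v_2$ by attaching $s$ pendant edges at $v_1$ and $t$ pendant edges at $v_2$. *)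

(* Defs.v *)
From HB Require Import structures.
From mathcomp Require Import all_boot all_order all_algebra.
From mathcomp Require Import classical_sets reals.

Set Implicit Arguments.
Unset Strict Implicit.
Unset Printing Implicit Defensive.

Import Order.TTheory GRing.Theory Num.Theory.
Local Open Scope ring_scope.

Record sgraph := SGraph {
  vertex :> finType;
  adj : rel vertex;
  adj_sym : symmetric adj;
  adj_irr : irreflexive adj }.

Definition graph_order (G : sgraph) : nat := #|G|.

Definition degree (G : sgraph) (x : G) : nat := #|[set y | adj x y]|.

Definition graph_connected (G : sgraph) : Prop :=
  (0 < graph_order G)%N /\ forall x y : G, connect (@adj G) x y.

Definition independent (G : sgraph) (S : {set G}) : bool :=
  [forall x in S, forall y in S, ~~ adj x y].

Definition independence_number (G : sgraph) : nat :=
  \max_(S : {set G} | independent S) #|S|.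

Definition graph_isomorphic (G H : sgraph) : Prop :=
  exists2 f : G -> H, bijective f & forall x y, adj (f x) (f y) = adj x y.

(* Rows and columns are indexed by the vertices through [enum_val]. *)
Definition adjacency_mx (R : realType) (G : sgraph) : 'M[R]_(graph_order G) :=
  \matrix_(i, j) (adj (enum_val i : G) (enum_val j : G))%:R.

Definition degree_mx (R : realType) (G : sgraph) : 'M[R]_(graph_order G) :=
  diag_mx (\row_i (degree (enum_val i : G))%:R).

Definition A_alpha (R : realType) (alpha : R) (G : sgraph) : 'M[R]_(graph_order G) :=
  alpha *: degree_mx R G + (1 - alpha) *: adjacency_mx R G.

(* The eigenvalues of a real symmetric matrix of positive size form a finite
   nonempty set of reals, so this supremum is attained: it is the largest
   eigenvalue. *)
Definition lambda_alpha (R : realType) (alpha : R) (G : sgraph) : R :=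
  sup [set a : R | eigenvalue (A_alpha alpha G) a]%classic.

(* Vertices 0, 1, 2 are v_1, v_2, v_3; the vertices 3, ..., s + 2 are pendant
   at v_1 and the vertices s + 3, ..., s + t + 2 are pendant at v_2. *)
Definition G2_arc (s : nat) (i j : nat) : bool :=
  [|| (i == 0) && (j == 2), (i == 1) && (j == 2),
      (i == 0) && (3 <= j < s + 3) | (i == 1) && (s + 3 <= j)]%N.

Definition G2_adj (s t : nat) : rel 'I_(s + t + 3) :=
  fun i j => G2_arc s i j || G2_arc s j i.

Lemma G2_sym (s t : nat) : symmetric (@G2_adj s t).
Proof. by move=> i j; rewrite /G2_adj orbC. Qed.

Lemma G2_irr (s t : nat) : irreflexive (@G2_adj s t).
Proof.
move=> i; rewrite /G2_adj /G2_arc orbb.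
by case: (nat_of_ord i) => [|[|[|k]]] //=; rewrite addn3.
Qed.

Definition G2 (s t : nat) : sgraph := SGraph (@G2_sym s t) (@G2_irr s t).

(* Main.v *)
Require Import Defs.
From HB Require Import structures.
From mathcomp Require Import all_boot all_order all_algebra.
From mathcomp Require Import classical_sets reals.
From mathcomp Require Import ring lra zify.

Set Implicit Arguments.
Unset Strict Implicit.
Unset Printing Implicit Defensive.

Import Order.TTheory GRing.Theory Num.Theory.
Local Open Scope ring_scope.

(** Let [u, v] be the complement of a maximum independent set of [G]; every
    other vertex is adjacent to [u] or [v] only.  The positive eigenvector of
    the balanced tree [G_2(s,t)] takes values [x1, x2, z] at [v_1, v_2, v_3] and
    [p, q] at the leaves, with [x2 <= x1] since [t <= s].  These values are
    placed on [G] so that [s] vertices receive [p] and [t] receive [q], and the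
    Rayleigh quotient of [G] at this function is compared with the eigenvalue
    of the tree edge by edge: each move of an edge goes towards a larger value.

    - If [u] and [v] have a common neighbour, it receives [z] while [u, v]
      receive [x1, x2], [u] being the vertex with more neighbours.  Equality
      makes the function an eigenvector of [G], and the eigenvalue equations at
      [u] and [v] leave room for no edge beyond those of the tree.
    - Otherwise [G] is a double star.  According to the order of [x1, x2, z],
      the values [x1, x2, z] are given to [u], [v] and one leaf; the eigenvalue
      equation fails at this leaf, so that the inequality is strict. *)

(** * Quadratic forms and the largest eigenvalue of a symmetric matrix *)

Section QuadraticForms.
Variables (R : realType) (n : nat).
Implicit Types (A B : 'M[R]_n) (x y : 'rV[R]_n).

(** Vectors are rows because [eigenvalue] refers to left eigenvectors; [bform 1%:M] is the standard
    inner product. *)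
Definition bform A x y : R := (x *m A *m y^T) 0 0.

Lemma bformE A x y : bform A x y = \sum_j (x *m A) 0 j * y 0 j.
Proof. by rewrite /bform mxE; apply: eq_bigr => j _; rewrite [_^T _ _]mxE. Qed.

Lemma bform1 x : bform 1%:M x x = \sum_j x 0 j ^+ 2.
Proof. by rewrite /bform mulmx1 mxE; apply: eq_bigr => j _; rewrite mxE expr2. Qed.

Lemma bform1_gt0 x : x != 0 -> 0 < bform 1%:M x x.
Proof.
move=> x0; rewrite bform1 lt_neqAle sumr_ge0 ?andbT; last first.
  by move=> i _; rewrite sqr_ge0.
apply: contraNneq x0 => e; apply/eqP/rowP => j; rewrite mxE.
apply/eqP; rewrite -sqrf_eq0; apply/eqP.
by apply: (psumr_eq0P _ (esym e)) => // i _; rewrite sqr_ge0.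
Qed.

Lemma bformC A x y : A^T = A -> bform A x y = bform A y x.
Proof.
move=> sA; rewrite /bform; transitivity ((x *m A *m y^T)^T 0 0); first by rewrite [RHS]mxE.
by rewrite !trmx_mul trmxK sA mulmxA.
Qed.

Lemma bformDl A x1 x2 y : bform A (x1 + x2) y = bform A x1 y + bform A x2 y.
Proof. by rewrite /bform !mulmxDl mxE. Qed.

Lemma bformZl A a x y : bform A (a *: x) y = a * bform A x y.
Proof. by rewrite /bform -!scalemxAl mxE. Qed.

Lemma bformDr A x y1 y2 : bform A x (y1 + y2) = bform A x y1 + bform A x y2.
Proof. by rewrite /bform linearD mulmxDr mxE. Qed.

Lemma bformZr A a x y : bform A x (a *: y) = a * bform A x y.
Proof. by rewrite /bform linearZ -scalemxAr mxE. Qed.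

Lemma bform_scalarB A a x y :
  bform (a%:M - A) x y = a * bform 1%:M x y - bform A x y.
Proof.
by rewrite /bform mulmxBr mulmxBl mul_mx_scalar mulmx1 -scalemxAl !mxE.
Qed.

(** A crude entrywise bound is enough; the summand 1 keeps [K] positive, so that it can be
    inverted. *)
Lemma bform_bounded A :
  exists2 K, 0 < K & forall x, bform A x x <= K * bform 1%:M x x.
Proof.
exists (1 + \sum_j \sum_i `|A i j|).
  by rewrite ltr_pwDl // sumr_ge0 // => j _; rewrite sumr_ge0.
move=> x; set N := bform 1%:M x x.
have N0 : 0 <= N by rewrite /N bform1 sumr_ge0 // => j _; rewrite sqr_ge0.
have le_N i : x 0 i ^+ 2 <= N.
  rewrite /N bform1 (bigD1 i) //= lerDl sumr_ge0 // => j _; exact: sqr_ge0.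
rewrite mulrDl mul1r ler_wpDl // mulr_suml bformE; apply: ler_sum => j _.
rewrite mxE !mulr_suml; apply: ler_sum => i _.
have [h1 h2] := (le_N i, le_N j).
have : `|x 0 i * A i j * x 0 j| <= `|A i j| * N.
  rewrite mulrAC mulrC normrM ler_wpM2l // ler_norml; nra.
exact/le_trans/ler_norm.
Qed.

Definition psd B := forall x, 0 <= bform B x x.

Lemma psd_cauchy_schwarz B x y : B^T = B -> psd B ->
  bform B x y ^+ 2 <= bform B x x * bform B y y.
Proof.
move=> sB pB.
have expand a b : bform B (a *: x + b *: y) (a *: x + b *: y) =
    a ^+ 2 * bform B x x + 2 * a * b * bform B x y + b ^+ 2 * bform B y y.
  rewrite !(bformDl, bformDr, bformZl, bformZr) (bformC y x sB); ring.
have := pB y; rewrite le_eqVlt => /predU1P[y0|y0].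
  rewrite -y0 mulr0; have [->|b0] := eqVneq (bform B x y) 0; first by rewrite expr0n.
  (* The form is affine along [y] here, and this coefficient brings it to the value -1. *)
  have := pB (1 *: x + (- (bform B x x + 1) / (2 * bform B x y)) *: y).
  rewrite expand -y0 mulr0 addr0 expr1n mul1r mulr1.
  have -> : 2 * (- (bform B x x + 1) / (2 * bform B x y)) * bform B x y =
    - (bform B x x + 1) by field.
  lra.
(* Up to the factor [bform B y y], this is the component of [x] orthogonal to [y]. *)
have := pB (bform B y y *: x + (- bform B x y) *: y).
rewrite expand.
have -> : bform B y y ^+ 2 * bform B x x +
  2 * bform B y y * - bform B x y * bform B x y + (- bform B x y) ^+ 2 * bform B y y
  = bform B y y * (bform B x x * bform B y y - bform B x y ^+ 2) by ring.
by rewrite pmulr_rge0 // subr_ge0.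
Qed.

(** Cauchy-Schwarz against [x *m B] bounds the squared norm of [x *m B], because that norm is itself
    a value of the form. *)
Lemma psd_isotropic B x : B^T = B -> psd B -> bform B x x = 0 -> x *m B = 0.
Proof.
move=> sB pB x0; apply/eqP/negPn/negP => xB0.
have := psd_cauchy_schwarz x (x *m B) sB pB; rewrite x0 mul0r.
have -> : bform B x (x *m B) = bform 1%:M (x *m B) (x *m B).
  by rewrite /bform mulmx1.
by rewrite leNgt exprn_gt0 // bform1_gt0.
Qed.

(* If [M] is the supremum of the Rayleigh quotients and [M - A] were
   invertible, Cauchy-Schwarz for the semidefinite form [M - A] applied to [x]
   and [x (M - A)^-1] would bound it below by a multiple of the identity, so
   that [M] could be decreased. *)
Lemma symmetric_max_eigenvalue A : (0 < n)%N -> A^T = A ->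
  exists2 M, eigenvalue A M & forall x, bform A x x <= M * bform 1%:M x x.
Proof.
move=> n0 sA.
pose E : set R :=
  [set r | exists2 x : 'rV_n, x != 0 & r = bform A x x / bform 1%:M x x]%classic.
have [K _ boundK] := bform_bounded A.
have E0 : (E !=set0)%classic.
  exists (bform A (const_mx 1) (const_mx 1) / bform 1%:M (const_mx 1) (const_mx 1)).
  exists (const_mx 1) => //; apply/eqP => /rowP/(_ (Ordinal n0)).
  by rewrite !mxE; apply/eqP; rewrite oner_eq0.
have ubE : has_ubound E.
  by exists K => r [x x0 ->]; rewrite ler_pdivrMr ?bform1_gt0.
have le_sup x : bform A x x <= sup E * bform 1%:M x x.
  have [->|x0] := eqVneq x 0; first by rewrite /bform !mul0mx mxE mulr0.
  rewrite -ler_pdivrMr ?bform1_gt0 //; apply: ub_le_sup => //.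
  by exists x.
exists (sup E) => //; pose B := (sup E)%:M - A.
have sB : B^T = B by rewrite /B linearB /= tr_scalar_mx sA.
have pB : psd B by move=> x; rewrite bform_scalarB subr_ge0.
rewrite -[eigenvalue _ _]/(kermx (A - (sup E)%:M) != 0) kermx_eq0 row_free_unit.
rewrite -(unitmxZ _ (unitrN1 R)) scaleN1r opprB -/B; apply/negP => uB.
have [K' K'0 boundK'] := bform_bounded (invmx B).
suff : sup E <= sup E - K'^-1.
  by move: K'0; rewrite -invr_gt0; lra.
apply: ge_sup => // r [x x0 ->]; have xx0 := bform1_gt0 x0.
have sC : (invmx B)^T = invmx B by rewrite trmx_inv sB.
have := psd_cauchy_schwarz x (x *m invmx B) sB pB.
have -> : bform B x (x *m invmx B) = bform 1%:M x x.
  by rewrite /bform trmx_mul sC mulmx1 -!mulmxA (mulmxA B) mulmxV // mul1mx.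
have -> : bform B (x *m invmx B) (x *m invmx B) = bform (invmx B) x x.
  by rewrite /bform trmx_mul sC -!mulmxA (mulmxA B) mulmxV // mul1mx.
move=> h; have := le_trans h (ler_wpM2l (pB x) (boundK' x)).
rewrite expr2 mulrA ler_pM2r // bform_scalarB => h2.
rewrite ler_pdivrMr // mulrBl lerBrDl -lerBrDr.
by rewrite ler_pdivrMl // mulrC.
Qed.

End QuadraticForms.

(** * The spectrum of a graph *)

Section GraphSpectrum.
Variables (R : realType) (alpha : R).
Implicit Types G H : sgraph.

(** The action of [A_alpha] on functions of the vertices. The diagonal term is spread over the edges
    at [v], so that everything is a sum over neighbours. *)
Definition Aop G (y : G -> R) (v : G) : R :=
  \sum_(w | adj v w) (alpha * y v + (1 - alpha) * y w).

Definition row_of G (y : G -> R) : 'rV[R]_(graph_order G) :=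
  \row_i y (enum_val i).

Lemma row_ofK G (x : 'rV[R]_(graph_order G)) :
  row_of (fun v => x 0 (enum_rank v)) = x.
Proof. by apply/rowP => i; rewrite mxE enum_valK. Qed.

Lemma sum_enum_val G (F : G -> R) :
  \sum_(i < graph_order G) F (enum_val i) = \sum_v F v.
Proof. by rewrite [RHS](reindex _ (onW_bij _ (enum_val_bij G))). Qed.

Lemma row_of_mul G (y : G -> R) :
  row_of y *m A_alpha alpha G = row_of (Aop y).
Proof.
rewrite /A_alpha mulmxDr -!scalemxAr; apply/rowP => i.
rewrite mxE [in X in X + _]mxE [in X in _ + X]mxE [RHS]mxE /Aop big_split /=.
congr (_ + _).
  rewrite /degree_mx mul_mx_diag !mxE sumr_const /degree cardsE.
  by rewrite [y _ * _]mulrC mulrCA mulr_natl.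
rewrite -mulr_sumr mxE; congr (_ * _); rewrite [RHS]big_mkcond /= -sum_enum_val.
apply: eq_bigr => k _; rewrite !mxE adj_sym.
by case: adj; rewrite ?mulr1 ?mulr0.
Qed.

Lemma bform_row_of G (y : G -> R) :
  bform (A_alpha alpha G) (row_of y) (row_of y) = \sum_v y v * Aop y v.
Proof.
rewrite bformE row_of_mul -sum_enum_val; apply: eq_bigr => i _.
by rewrite !mxE mulrC.
Qed.

Lemma bform1_row_of G (y : G -> R) :
  bform 1%:M (row_of y) (row_of y) = \sum_v y v ^+ 2.
Proof. by rewrite bform1 -sum_enum_val; apply: eq_bigr => i _; rewrite mxE. Qed.

Lemma A_alpha_tr G : (A_alpha alpha G)^T = A_alpha alpha G.
Proof.
apply/matrixP => i j; rewrite !mxE adj_sym; congr (_ * _ + _).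
by rewrite [j == i]eq_sym; case: eqVneq => [->|].
Qed.

Lemma eigenvalue_Aop G a :
  eigenvalue (A_alpha alpha G) a <->
  exists2 y : G -> R, exists v, y v != 0 & forall v, Aop y v = a * y v.
Proof.
split=> [/eigenvalueP[x xA x0]|[y [v yv0] yA]].
  exists (fun v => x 0 (enum_rank v)).
    have /rV0Pn[i xi0] := x0; exists (enum_val i); by rewrite enum_valK.
  move=> v; move: xA; rewrite -{1}[x]row_ofK row_of_mul.
  by move/rowP/(_ (enum_rank v)); rewrite !mxE enum_rankK.
apply/eigenvalueP; exists (row_of y).
  by rewrite row_of_mul; apply/rowP => i; rewrite !mxE yA.
by apply/rV0Pn; exists (enum_rank v); rewrite mxE enum_rankK.
Qed.

(** The Rayleigh bound at an eigenvector shows that no eigenvalue exceeds the one that attains the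
    bound, so it is the supremum of the spectrum. *)
Lemma lambda_alphaP G : (0 < graph_order G)%N ->
  eigenvalue (A_alpha alpha G) (lambda_alpha alpha G) /\
  forall x, bform (A_alpha alpha G) x x <= lambda_alpha alpha G * bform 1%:M x x.
Proof.
move=> G0; have [M eM maxM] := symmetric_max_eigenvalue G0 (A_alpha_tr G).
suff -> : lambda_alpha alpha G = M by [].
have ubM : ubound [set a : R | eigenvalue (A_alpha alpha G) a]%classic M.
  move=> a /eigenvalueP[x xA x0].
  have := maxM x; rewrite {1}/bform xA -{1}[x]mulmx1 scalemxAl -/(bform _ _ _).
  by rewrite bformZl ler_pM2r ?bform1_gt0.
apply/eqP; rewrite eq_le; apply/andP; split.
  by apply: ge_sup => //; exists M.
by apply: ub_le_sup => //; exists M.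
Qed.

Lemma rayleigh_le G (y : G -> R) : (0 < graph_order G)%N ->
  \sum_v y v * Aop y v <= lambda_alpha alpha G * \sum_v y v ^+ 2.
Proof.
by move=> G0; rewrite -bform_row_of -bform1_row_of; apply: (lambda_alphaP G0).2.
Qed.

(** A function attaining the Rayleigh bound is isotropic for the semidefinite form of
    $\lambda_\alpha I-A_\alpha$, hence in its kernel. *)
Lemma rayleigh_eigenfunction G (y : G -> R) : (0 < graph_order G)%N ->
  lambda_alpha alpha G * \sum_v y v ^+ 2 <= \sum_v y v * Aop y v ->
  forall v, Aop y v = lambda_alpha alpha G * y v.
Proof.
move=> G0; set l := lambda_alpha _ _ => le_l v.
have eq_l : bform (l%:M - A_alpha alpha G) (row_of y) (row_of y) = 0.
  rewrite bform_scalarB bform_row_of bform1_row_of; apply/eqP.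
  by rewrite subr_eq0 eq_le le_l rayleigh_le.
have /rowP/(_ (enum_rank v)) : row_of y *m (l%:M - A_alpha alpha G) = 0.
  apply: psd_isotropic => // [|x].
    by rewrite linearB /= tr_scalar_mx A_alpha_tr.
  by rewrite bform_scalarB subr_ge0; apply: (lambda_alphaP G0).2.
rewrite mulmxBr row_of_mul mul_mx_scalar !mxE enum_rankK.
by move/eqP; rewrite subr_eq0 => /eqP.
Qed.

Lemma graph_isomorphic_sym G H : graph_isomorphic G H -> graph_isomorphic H G.
Proof.
move=> [f [g fK gK] fadj]; exists g; first by exists f.
by move=> x y; rewrite -fadj !gK.
Qed.

Lemma eigenvalue_isomorphic G H a : graph_isomorphic G H ->
  eigenvalue (A_alpha alpha H) a -> eigenvalue (A_alpha alpha G) a.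
Proof.
move=> [f [g fK gK] fadj] /eigenvalue_Aop[y [v yv0] yA]; apply/eigenvalue_Aop.
exists (y \o f); first by exists (g v); rewrite /= gK.
move=> w; rewrite /= -yA /Aop [RHS](reindex f) /=; last by exists g => ? _.
by apply: eq_big => // u; rewrite fadj.
Qed.

Lemma lambda_alpha_isomorphic G H : graph_isomorphic G H ->
  lambda_alpha alpha G = lambda_alpha alpha H.
Proof.
move=> GH; congr sup; apply/seteqP; split=> a /=.
  exact/eigenvalue_isomorphic/graph_isomorphic_sym.
exact: eigenvalue_isomorphic.
Qed.

(** * Perron vectors of connected graphs *)

Hypothesis halpha : 0 <= alpha < 1.

(** Replacing an eigenfunction by its absolute value does not lower the Rayleigh quotient, so the
    result is again an eigenfunction; connectedness and $\alpha<1$ then exclude zeros. *)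
Lemma perron_positive G : graph_connected G ->
  exists2 y : G -> R, forall v, 0 < y v &
    forall v, Aop y v = lambda_alpha alpha G * y v.
Proof.
move=> [G0 conG]; have [e _] := lambda_alphaP G0.
have /eigenvalue_Aop[y [v0 yv0] yA] := e.
set l := lambda_alpha alpha G in yA *.
have beta0 : 0 < 1 - alpha by rewrite subr_gt0; case/andP: halpha.
have zA : forall v, Aop (fun v => `|y v|) v = l * `|y v|.
  apply: rayleigh_eigenfunction => //.
  have -> : \sum_v `|y v| ^+ 2 = \sum_v y v ^+ 2.
    by apply: eq_bigr => v _; rewrite real_normK ?num_real.
  rewrite mulr_sumr; apply: ler_sum => v _.
  have -> : l * y v ^+ 2 = y v * Aop y v by rewrite yA; ring.
  rewrite /Aop !mulr_sumr; apply: ler_sum => w _.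
  rewrite !mulrDr [y v * (alpha * _)]mulrCA [`|y v| * (alpha * _)]mulrCA.
  rewrite -!expr2 real_normK ?num_real // lerD2l.
  rewrite [y v * _]mulrCA [`|y v| * _]mulrCA -normrM ler_pM2l //.
  exact: ler_norm.
exists (fun v => `|y v|) => // v; rewrite normr_gt0.
apply: contraNneq yv0 => yv; have /connectP[p pth ->] := conG v v0.
(* At a zero the eigenvalue equation is a vanishing sum of nonnegative terms, so all neighbours are
   zeros too; this propagates along the path to [v0]. *)
elim: p v pth yv => [v _ ->|w p IH v] //= /andP[vw pth] yv; apply: IH pth _.
have sum0 := zA v; rewrite yv normr0 mulr0 in sum0.
have : alpha * `|y v| + (1 - alpha) * `|y w| = 0.
  apply: (psumr_eq0P _ sum0) => // u _.
  by rewrite addr_ge0 // mulr_ge0 // ?(ltW beta0) //; case/andP: halpha.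
rewrite yv normr0 mulr0 add0r => /eqP.
by rewrite mulf_eq0 normr_eq0 gt_eqF //= => /eqP.
Qed.

End GraphSpectrum.

(** * The eigenvector of the tree *)

Lemma card_ord_interval N a b : (a <= b)%N -> (b <= N)%N ->
  #|[set i : 'I_N | (a <= i < b)%N]| = (b - a)%N.
Proof.
move=> ab bN; transitivity (\sum_(a <= i < b) 1)%N; last first.
  by rewrite sum_nat_const_nat muln1.
rewrite (big_nat_widen _ _ N) // big_geq_mkord -sum1dep_card.
by apply: eq_bigl => i /=; rewrite andbC.
Qed.

Section BalancedTree.
Variables (R : realType) (alpha : R).
Hypothesis halpha : 0 <= alpha < 1.

(** The eigenvalue equations at $v_1$, $v_2$, $v_3$ and at a leaf of each side, for a positive
    function constant on the leaves of each side. *)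
Record G2_eigenvector (s t : nat) (l x1 x2 z p q : R) : Prop := G2Eigenvector {
  x1_gt0 : 0 < x1; x2_gt0 : 0 < x2; z_gt0 : 0 < z; p_gt0 : 0 < p; q_gt0 : 0 < q;
  x1_eq : (alpha * x1 + (1 - alpha) * z)
          + s%:R * (alpha * x1 + (1 - alpha) * p) = l * x1;
  x2_eq : (alpha * x2 + (1 - alpha) * z)
          + t%:R * (alpha * x2 + (1 - alpha) * q) = l * x2;
  z_eq : (alpha * z + (1 - alpha) * x1) + (alpha * z + (1 - alpha) * x2) = l * z;
  p_eq : alpha * p + (1 - alpha) * x1 = l * p;
  q_eq : alpha * q + (1 - alpha) * x2 = l * q }.

(** Eliminating $l$ between the equations at $v_1$ and $v_2$ expresses $(1-\alpha)z(x_2-x_1)$ as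
    $-(s-t)$ times a positive quantity. *)
Lemma G2_eigenvector_ge s t l x1 x2 z p q : (t <= s)%N ->
  G2_eigenvector s t l x1 x2 z p q -> x2 <= x1.
Proof.
move=> ts [x10 x20 z0 p0 q0 e1 e2 ez ep eq]; rewrite leNgt; apply/negP => lt12.
have [a0 a1] := andP halpha.
have st : t%:R <= s%:R :> R by rewrite ler_nat.
have t0 : 0 <= t%:R :> R by [].
have k0 : 0 < l - alpha by nra.
(* Both leaf values are the same multiple of the value at their parent. *)
have cross : (l - alpha) * (p * x2) = (l - alpha) * (q * x1).
  have -> : (l - alpha) * (p * x2) = (1 - alpha) * x1 * x2 by nra.
  by nra.
have {}cross : p * x2 = q * x1 by apply: (mulfI (lt0r_neq0 k0)).
have E1 : ((l - alpha) - s%:R * alpha) * x1 - s%:R * (1 - alpha) * p = (1 - alpha) * z.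
  by lra.
have E2 : ((l - alpha) - t%:R * alpha) * x2 - t%:R * (1 - alpha) * q = (1 - alpha) * z.
  by lra.
have : (1 - alpha) * z * x2 = (1 - alpha) * z * x1
        - (s%:R - t%:R) * (alpha * x1 * x2 + (1 - alpha) * (q * x1)).
  have /= := congr1 (fun r => r * x2) E1; have /= := congr1 (fun r => r * x1) E2.
  have /= := congr1 (fun r => s%:R * (1 - alpha) * r) cross; lra.
have : 0 < (1 - alpha) * z * (x2 - x1) by rewrite !mulr_gt0 ?subr_gt0.
have : 0 <= (s%:R - t%:R) * (alpha * x1 * x2 + (1 - alpha) * (q * x1)).
  rewrite mulr_ge0 ?subr_ge0 // addr_ge0 ?mulr_ge0 ?subr_ge0 //; exact: ltW.
lra.
Qed.

(** The contribution to the quadratic form of $A_\alpha$ of one edge whose ends have values [a] and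
    [b]. *)
Definition edge_form (a b : R) : R :=
  alpha * (a ^+ 2 + b ^+ 2) + 2 * (1 - alpha) * a * b.

Lemma edge_form_ge0 a b : 0 <= a -> 0 <= b -> 0 <= edge_form a b.
Proof.
have [a0 a1] := andP halpha => ? ?; have b0 : 0 <= 1 - alpha by lra.
apply: addr_ge0; first by rewrite mulr_ge0 // addr_ge0 // sqr_ge0.
by do 3 apply: mulr_ge0 => //.
Qed.

Lemma edge_form_mono a a' b : 0 <= a -> a <= a' -> 0 <= b ->
  edge_form a b <= edge_form a' b.
Proof.
have [a0 a1] := andP halpha => ? ? ?; rewrite /edge_form lerD //.
  by rewrite ler_wpM2l // lerD2r lerXn2r // nnegrE; lra.
by rewrite ler_wpM2r // ler_wpM2l // mulr_ge0 // subr_ge0 ltW.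
Qed.

Lemma edge_formC a b : edge_form a b = edge_form b a.
Proof. rewrite /edge_form; ring. Qed.

(** Each equation is multiplied by the value at its vertex; summing over the vertices collects the
    two halves of every edge. *)
Lemma G2_eigenvector_form s t l x1 x2 z p q :
  G2_eigenvector s t l x1 x2 z p q ->
  edge_form x1 z + edge_form x2 z
    + s%:R * edge_form x1 p + t%:R * edge_form x2 q
  = l * (x1 ^+ 2 + x2 ^+ 2 + z ^+ 2 + s%:R * p ^+ 2 + t%:R * q ^+ 2).
Proof.
move=> [_ _ _ _ _ e1 e2 ez ep eq].
have -> : l * (x1 ^+ 2 + x2 ^+ 2 + z ^+ 2 + s%:R * p ^+ 2 + t%:R * q ^+ 2) =
  (l * x1) * x1 + (l * x2) * x2 + (l * z) * z + s%:R * ((l * p) * p)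
  + t%:R * ((l * q) * q) by ring.
rewrite -e1 -e2 -ez -ep -eq /edge_form; ring.
Qed.

(** * The Perron vector of $G_2(s,t)$ and its five values *)

Section G2Graph.
Variables s t : nat.

Let N_gt k : (k < 3)%N -> (k < s + t + 3)%N. Proof. lia. Qed.
Let v1 : G2 s t := Ordinal (N_gt (isT : 0 < 3)%N).
Let v2 : G2 s t := Ordinal (N_gt (isT : 1 < 3)%N).
Let v3 : G2 s t := Ordinal (N_gt (isT : 2 < 3)%N).
Let P1 : {set G2 s t} := [set i : 'I_(s + t + 3) | 3 <= i < s + 3]%N.
Let P2 : {set G2 s t} := [set i : 'I_(s + t + 3) | s + 3 <= i < s + t + 3]%N.

Lemma G2_connected : graph_connected (G2 s t).
Proof.
split; first by rewrite /graph_order card_ord addn3.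
have sym : connect_sym (@adj (G2 s t)) := sym_connect_sym (@adj_sym _).
suff to3 i : connect (@adj (G2 s t)) i v3.
  by move=> i j; rewrite (connect_trans (to3 i)) // sym.
have v13 : connect (@adj (G2 s t)) v1 v3 by apply: connect1.
have v23 : connect (@adj (G2 s t)) v2 v3 by apply: connect1.
case: (ltnP i (s + 3)) => si.
  case: i si => [[|[|[|i]]] hi] si.
  - by rewrite (_ : Ordinal hi = v1) //; apply: val_inj.
  - by rewrite (_ : Ordinal hi = v2) //; apply: val_inj.
  - by rewrite (_ : Ordinal hi = v3) //; apply: val_inj.
  apply: connect_trans v13; apply: connect1.
  by rewrite /= /G2_adj /G2_arc /= in si *; rewrite si.
apply: connect_trans v23; apply: connect1.
by rewrite /= /G2_adj /G2_arc /= si !orbT.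
Qed.

(** No symmetry argument is needed for constancy on leaves: since $l>\alpha$, the equation at a leaf
    determines its value from that of its parent. *)
Lemma G2_eigenvector_exists : (0 < t)%N ->
  exists x1 x2 z p q,
    G2_eigenvector s t (lambda_alpha alpha (G2 s t)) x1 x2 z p q.
Proof.
move=> t0; have [y y0 yA] := perron_positive halpha G2_connected.
set l := lambda_alpha _ _ in yA *.
have [a0 a1] := andP halpha; have b0 : 0 < 1 - alpha by rewrite subr_gt0.
have adj1 i : adj v1 i = (i == v3) || (i \in P1).
  rewrite inE -val_eqE /= /G2_adj /G2_arc /=; case: i => [[|[|[|i]]] hi] /=; lia.
have adj2 i : adj v2 i = (i == v3) || (i \in P2).
  rewrite inE -val_eqE /= /G2_adj /G2_arc /=; case: i => [[|[|[|i]]] hi] /=; lia.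
have adj3 i : adj v3 i = (i == v1) || (i == v2).
  rewrite -!val_eqE /= /G2_adj /G2_arc /=; case: i => [[|[|[|i]]] hi] //=; lia.
have leaf1 i : i \in P1 -> (l - alpha) * y i = (1 - alpha) * y v1.
  move=> iP; have := yA i; rewrite /Aop (big_pred1 v1); last first.
    move=> j; rewrite adj_sym /=; move: iP; rewrite inE -val_eqE /=.
    rewrite /G2_adj /G2_arc /=; lia.
  lra.
have leaf2 i : i \in P2 -> (l - alpha) * y i = (1 - alpha) * y v2.
  move=> iP; have := yA i; rewrite /Aop (big_pred1 v2); last first.
    move=> j; rewrite adj_sym /=; move: iP; rewrite inE -val_eqE /=.
    rewrite /G2_adj /G2_arc /=; lia.
  lra.
(* As $t>0$, the vertex $s+3$ is a leaf at $v_2$, and its equation gives the sign. *)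
have k0 : 0 < l - alpha.
  have sN : (s + 3 < s + t + 3)%N by lia.
  have /leaf2 e : (Ordinal sN : G2 s t) \in P2 by rewrite inE /= leqnn.
  by rewrite -(pmulr_lgt0 _ (y0 (Ordinal sN))) e mulr_gt0.
have leafE i v : (l - alpha) * y i = (1 - alpha) * y v ->
    y i = (1 - alpha) * y v / (l - alpha).
  by move=> <-; rewrite mulrAC mulfV ?mul1r ?gt_eqF.
(* The leaf values are given by formula, so that [p] makes sense even when $s=0$. *)
exists (y v1), (y v2), (y v3), ((1 - alpha) * y v1 / (l - alpha)),
  ((1 - alpha) * y v2 / (l - alpha)).
split=> //; rewrite ?divr_gt0 ?mulr_gt0 //.
- rewrite -yA /Aop (bigD1 v3) ?adj1 ?eqxx //; congr (_ + _).
  rewrite (eq_bigl (mem P1)) => [|i]; last first.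
    rewrite adj1; case: eqVneq => [->|] /=; rewrite ?andbT ?inE //.
  rewrite (eq_bigr _ (fun i iP => congr1 (fun r => alpha * y v1 + (1 - alpha) * r)
    (leafE i v1 (leaf1 i iP)))).
  by rewrite sumr_const card_ord_interval ?addnK ?mulr_natl //; lia.
- rewrite -yA /Aop (bigD1 v3) ?adj2 ?eqxx //; congr (_ + _).
  rewrite (eq_bigl (mem P2)) => [|i]; last first.
    rewrite adj2; case: eqVneq => [->|] /=; rewrite ?andbT ?inE //=; lia.
  rewrite (eq_bigr _ (fun i iP => congr1 (fun r => alpha * y v2 + (1 - alpha) * r)
    (leafE i v2 (leaf2 i iP)))).
  rewrite sumr_const card_ord_interval ?mulr_natl //; last by lia.
  by congr (_ *+ _); lia.
- rewrite -yA /Aop (bigD1 v1) ?adj3 ?eqxx //; congr (_ + _).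
  rewrite (big_pred1 v2) // => i; rewrite adj3 /=.
  by case: eqVneq => [->|]; rewrite ?andbF ?andbT.
- by field; rewrite gt_eqF.
- by field; rewrite gt_eqF.
Qed.

End G2Graph.
End BalancedTree.

(** * Test functions *)

Lemma subset_of_card (T : finType) (A : {set T}) k : (k <= #|A|)%N ->
  exists2 B : {set T}, B \subset A & #|B| = k.
Proof.
move=> kA; exists [set x in take k (enum A)].
  apply/fintype.subsetP => x; rewrite inE => /mem_take; by rewrite mem_enum.
rewrite cardsE; have /card_uniqP -> : uniq (take k (enum A)).
  exact/take_uniq/enum_uniq.
by rewrite size_takel // -cardE.
Qed.

Lemma ler_sum_const (R : realType) (I : finType) (A : {set I}) (F : I -> R) c :
  (forall i, i \in A -> c <= F i) -> #|A|%:R * c <= \sum_(i in A) F i.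
Proof. by move=> cF; rewrite mulr_natl -sumr_const; apply: ler_sum. Qed.

Section TestFunctions.
Variables (R : realType) (alpha : R) (G : sgraph) (u v : G).
Hypothesis uv : u != v.
Hypothesis indep : forall x y, x \in ~: [set u; v] -> y \in ~: [set u; v] -> ~~ adj x y.

Local Notation e := (edge_form alpha).

Lemma sum_split2 (F : G -> R) :
  \sum_x F x = F u + F v + \sum_(x in ~: [set u; v]) F x.
Proof.
rewrite (bigD1 u) // (bigD1 v) /=; last by rewrite eq_sym.
by rewrite addrA; congr (_ + _); apply: eq_bigl => x; rewrite !inE negb_or.
Qed.

(** The sum regrouped by edges: every edge meets [u] or [v], since the other vertices are
    independent. *)
Lemma rayleigh_sum (y : G -> R) :
  \sum_x y x * Aop alpha y x =
    (if adj u v then e (y u) (y v) else 0)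
    + \sum_(x in ~: [set u; v])
        ((if adj u x then e (y u) (y x) else 0)
         + (if adj v x then e (y v) (y x) else 0)).
Proof.
(* The half of the edge $xw$ that is counted at [x]. *)
pose F x w := if adj x w then y x * (alpha * y x + (1 - alpha) * y w) else 0.
have FE x w : F x w + F w x = if adj x w then e (y x) (y w) else 0.
  rewrite /F [adj w x]adj_sym; case: ifP => _; last by rewrite addr0.
  rewrite /edge_form; ring.
transitivity (\sum_x \sum_w F x w).
  by apply: eq_bigr => x _; rewrite /Aop mulr_sumr big_mkcond.
rewrite sum_split2 (sum_split2 (F u)) (sum_split2 (F v)).
have -> : \sum_(x in ~: [set u; v]) \sum_w F x w =
    \sum_(x in ~: [set u; v]) F x u + \sum_(x in ~: [set u; v]) F x v.
  rewrite -big_split; apply: eq_bigr => x xS /=; rewrite sum_split2.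
  by rewrite [X in _ + X]big1 ?addr0 // => w wS; rewrite /F (negbTE (indep xS wS)).
rewrite -FE [X in _ = _ + X](eq_bigr (fun x => (F u x + F x u) + (F v x + F x v))); last first.
  by move=> x _; rewrite !FE.
rewrite !big_split /=.
have -> : F v v = 0 by rewrite /F adj_irr.
have -> : F u u = 0 by rewrite /F adj_irr.
ring.
Qed.

(** How a test function is used: a Rayleigh quotient of at least [l] bounds $\lambda_\alpha$ below,
    and equality makes it an eigenfunction. *)
Lemma le_lambda_alpha (y : G -> R) l :
  (exists x, y x != 0) ->
  l * \sum_x y x ^+ 2 <= \sum_x y x * Aop alpha y x ->
  l <= lambda_alpha alpha G
  /\ (lambda_alpha alpha G = l -> forall x, Aop alpha y x = l * y x).
Proof.
move=> [x0 yx0] le_l.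
have G0 : (0 < graph_order G)%N by apply/card_gt0P; exists x0.
split=> [|ll]; last by rewrite -ll; apply: rayleigh_eigenfunction => //; rewrite ll.
have := le_trans le_l (rayleigh_le alpha y G0).
rewrite ler_pM2r // lt_neqAle sumr_ge0 => [|x _]; last exact: sqr_ge0.
rewrite andbT; apply: contraNneq yx0 => s0; rewrite -sqrf_eq0; apply/eqP.
by apply: (psumr_eq0P _ (esym s0)) => // x _; apply: sqr_ge0.
Qed.

Section Partition.
Variables (m : G) (P Q : {set G}).
Hypothesis partS : ~: [set u; v] = m |: (P :|: Q).
Hypothesis mPQ : m \notin P :|: Q.
Hypothesis disPQ : [disjoint P & Q].

Variables (a b c p q : R).

(** By [partS] the last branch is reached on [Q] only. When [P] and [Q] have sizes $s$ and $t$, the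
    norm is that of the tree eigenvector, in whatever order $x_1,x_2,z$ are placed on [u], [v],
    [m]. *)
Definition test_fun (x : G) : R :=
  if x == u then a else if x == v then b else if x == m then c
  else if x \in P then p else q.

Lemma test_u : test_fun u = a.
Proof. by rewrite /test_fun eqxx. Qed.

Lemma test_v : test_fun v = b.
Proof. by rewrite /test_fun eqxx eq_sym (negbTE uv). Qed.

Lemma test_rest x : x \in ~: [set u; v] ->
  test_fun x = if x == m then c else if x \in P then p else q.
Proof.
by rewrite !inE negb_or /test_fun => /andP[/negbTE-> /negbTE->].
Qed.

Lemma m_rest : m \in ~: [set u; v].
Proof. by rewrite partS setU11. Qed.

Lemma P_rest x : x \in P -> x \in ~: [set u; v].
Proof. by move=> xP; rewrite partS !inE xP orbT. Qed.

Lemma Q_rest x : x \in Q -> x \in ~: [set u; v].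
Proof. by move=> xQ; rewrite partS !inE xQ !orbT. Qed.

Lemma test_m : test_fun m = c.
Proof. by rewrite test_rest ?m_rest // eqxx. Qed.

Lemma test_P x : x \in P -> test_fun x = p.
Proof.
move=> xP; rewrite test_rest ?P_rest // xP.
by case: eqVneq => // xm; move: mPQ; rewrite -xm inE xP.
Qed.

Lemma test_Q x : x \in Q -> test_fun x = q.
Proof.
move=> xQ; rewrite test_rest ?Q_rest // (disjointFl disPQ xQ).
by case: eqVneq => // xm; move: mPQ; rewrite -xm inE xQ orbT.
Qed.

Lemma sum_rest (F : G -> R) : \sum_(x in ~: [set u; v]) F x =
  F m + \sum_(x in P) F x + \sum_(x in Q) F x.
Proof.
rewrite partS big_setU1 //= -addrA -bigU //; congr (_ + _).
by apply: eq_bigl => x; rewrite !inE.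
Qed.

Lemma test_norm : \sum_x test_fun x ^+ 2 =
  a ^+ 2 + b ^+ 2 + c ^+ 2 + #|P|%:R * p ^+ 2 + #|Q|%:R * q ^+ 2.
Proof.
rewrite sum_split2 sum_rest test_u test_v test_m !addrA.
rewrite !mulr_natl -!sumr_const.
by congr (_ + _ + _); apply: eq_bigr => x xA; rewrite ?(test_P xA) ?(test_Q xA).
Qed.

Lemma test_form : \sum_x test_fun x * Aop alpha test_fun x =
  (if adj u v then e a b else 0)
  + ((if adj u m then e a c else 0) + (if adj v m then e b c else 0))
  + \sum_(x in P) ((if adj u x then e a p else 0) + (if adj v x then e b p else 0))
  + \sum_(x in Q) ((if adj u x then e a q else 0) + (if adj v x then e b q else 0)).
Proof.
rewrite rayleigh_sum sum_rest test_u test_v test_m !addrA.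
by congr (_ + _ + _); apply: eq_bigr => x xA; rewrite ?(test_P xA) ?(test_Q xA).
Qed.

Lemma test_compare l : 0 < a ->
  l * (a ^+ 2 + b ^+ 2 + c ^+ 2 + #|P|%:R * p ^+ 2 + #|Q|%:R * q ^+ 2) <=
  (if adj u v then e a b else 0)
  + ((if adj u m then e a c else 0) + (if adj v m then e b c else 0))
  + \sum_(x in P) ((if adj u x then e a p else 0) + (if adj v x then e b p else 0))
  + \sum_(x in Q) ((if adj u x then e a q else 0) + (if adj v x then e b q else 0)) ->
  l <= lambda_alpha alpha G
  /\ (lambda_alpha alpha G = l ->
      forall x, Aop alpha test_fun x = l * test_fun x).
Proof.
move=> a0; rewrite -test_norm -test_form; apply: le_lambda_alpha.
by exists u; rewrite test_u gt_eqF.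
Qed.

End Partition.
End TestFunctions.

(** * Recognising the tree *)

Section Isomorphism.
Variables (G : sgraph) (u v m : G) (P Q : {set G}).
Hypothesis uv : u != v.
Hypothesis indep : forall x y, x \in ~: [set u; v] -> y \in ~: [set u; v] -> ~~ adj x y.
Hypothesis partS : ~: [set u; v] = m |: (P :|: Q).
Hypothesis mPQ : m \notin P :|: Q.
Hypothesis disPQ : [disjoint P & Q].
Hypothesis adju : forall x, adj u x = (x \in m |: P).
Hypothesis adjv : forall x, adj v x = (x \in m |: Q).

Local Notation s := #|P|.
Local Notation t := #|Q|.

(** The numbering follows that of [G2]: first [u], [v], [m], then [P] from 3 on and [Q] from $s+3$
    on. *)
Let code (x : G) : nat :=
  if x == u then 0%N else if x == v then 1%N else if x == m then 2%N
  else if x \in P then (index x (enum P)).+3 else (s + index x (enum Q)).+3.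

Let decode (k : nat) : G :=
  match k with
  | 0%N => u | 1%N => v | 2%N => m
  | k'.+3 => if (k' < s)%N then nth u (enum P) k' else nth u (enum Q) (k' - s)
  end.

Let rest x : (x != u) && (x != v) = [|| x == m, x \in P | x \in Q].
Proof. by have /setP/(_ x) := partS; rewrite !inE negb_or. Qed.

Let code_u : code u = 0%N. Proof. by rewrite /code eqxx. Qed.

Let code_v : code v = 1%N. Proof. by rewrite /code eqxx eq_sym (negbTE uv). Qed.

Let code_m : code m = 2%N.
Proof.
by have := rest m; rewrite /code eqxx /= => /andP[/negbTE-> /negbTE->].
Qed.

Let code_P x : x \in P -> code x = (index x (enum P)).+3 /\ (index x (enum P) < s)%N.
Proof.
move=> xP; rewrite cardE index_mem mem_enum; split=> //.
have := rest x; rewrite /code xP /= orbT => /andP[/negbTE-> /negbTE->].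
by case: (eqVneq x m) => // xm; move: mPQ; rewrite -xm inE xP.
Qed.

Let code_Q x : x \in Q ->
  code x = (s + index x (enum Q)).+3 /\ (index x (enum Q) < t)%N.
Proof.
move=> xQ; rewrite [t]cardE index_mem mem_enum; split=> //.
have := rest x; rewrite xQ !orbT /code => /andP[/negbTE-> /negbTE->].
rewrite (disjointFl disPQ xQ).
by case: (eqVneq x m) => // xm; move: mPQ; rewrite -xm inE xQ orbT.
Qed.

Let caseG (K : G -> Prop) : K u -> K v -> K m ->
  (forall x, x \in P -> K x) -> (forall x, x \in Q -> K x) -> forall x, K x.
Proof.
move=> Ku Kv Km KP KQ x; case: (eqVneq x u) => [->//|xu].
case: (eqVneq x v) => [->//|xv]; have := rest x; rewrite xu xv /=.
by case/esym/or3P => [/eqP->|/KP|/KQ].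
Qed.

Let codeK : cancel code decode.
Proof.
apply: caseG => [|||x xP|x xQ]; rewrite ?code_u ?code_v ?code_m //.
  by have [-> lt_s] := code_P xP; rewrite /decode lt_s nth_index ?mem_enum.
have [-> lt_t] := code_Q xQ.
by rewrite /decode ltnNge leq_addr /= addKn nth_index ?mem_enum.
Qed.

Let code_lt x : (code x < s + t + 3)%N.
Proof.
move: x; apply: caseG => [|||x /code_P[-> ?]|x /code_Q[-> ?]];
  rewrite ?code_u ?code_v ?code_m; lia.
Qed.

Let code_inP x : (3 <= code x < s + 3)%N = (x \in P).
Proof.
case: (boolP (x \in P)) => [/code_P[-> ]|/negbTE xP]; first by lia.
by rewrite /code xP; do 3 case: ifP => // _; lia.
Qed.

Let code_inQ x : (s + 3 <= code x)%N = (x \in Q).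
Proof.
case: (boolP (x \in Q)) => [/code_Q[-> ?]|/negbTE xQ]; first by lia.
have := rest x; rewrite xQ orbF; case: (boolP (x \in P)) => [/code_P[-> ? _]|xP].
  by lia.
rewrite /code (negbTE xP) orbF.
case: eqVneq => [_ _|_]; first by lia.
case: eqVneq => [_ _|_]; first by lia.
by case: eqVneq => [_ _|//]; lia.
Qed.

(** The numbering is injective between sets of equal size; adjacency is then compared according to
    which of the two vertices lie in $\{u,v\}$. *)
Lemma isomorphic_G2 : graph_isomorphic G (G2 #|P| #|Q|).
Proof.
pose f x : G2 s t := Ordinal (code_lt x).
have f_inj : injective f by move=> x y [] /(can_inj codeK).
exists f.
  apply: inj_card_bij => //; rewrite card_ord.
  rewrite -(cardsC [set u; v]) cards2 uv partS cardsU1 mPQ cardsU.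
  by rewrite (disjoint_setI0 disPQ) cards0; lia.
(* Arcs of [G2_arc] start at $v_1$ or $v_2$ only, so the first vertex must be [u] or [v]. *)
have arcE x y : G2_arc s (code x) (code y) =
    ((x == u) && adj u y) || ((x == v) && adj v y).
  have eqc w k : code w = k -> forall z, (code z == k) = (z == w).
    by move=> <- z; rewrite (inj_eq (can_inj codeK)).
  rewrite /G2_arc !(eqc _ _ code_u, eqc _ _ code_v, eqc _ _ code_m).
  rewrite code_inP code_inQ adju adjv !in_setU1.
  by case: (x == u); case: (x == v); case: (y == m); case: (y \in P).
move=> x y; rewrite /= /G2_adj /= !arcE.
case: (eqVneq x u) => [->|xu] /=.
  case: (eqVneq y u) => [->|yu] /=; first by rewrite adj_irr (negbTE uv).
  rewrite (negbTE uv) /= orbF; case: (eqVneq y v) => [->|_]; last by rewrite orbF.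
  by rewrite [adj v u]adj_sym; case: adj.
case: (eqVneq x v) => [->|xv] /=.
  case: (eqVneq y v) => [->|yv] /=; first by rewrite adj_irr eq_sym (negbTE uv).
  case: (eqVneq y u) => [->|_]; last by rewrite !orbF.
  by rewrite [adj u v]adj_sym; case: adj.
case: (eqVneq y u) => [->|yu] /=.
  by rewrite (negbTE uv) orbF adj_sym.
case: (eqVneq y v) => [->|yv] /=; first by rewrite adj_sym.
by apply/esym/negbTE/indep; rewrite !inE negb_or ?xu ?yu.
Qed.

End Isomorphism.

(** Only one of the two leaf classes has to be chosen; the other is the remainder, and its size
    follows. *)
Lemma complete_partition (T : finType) (S P : {set T}) m :
  m \in S -> P \subset S :\ m ->
  [/\ S = m |: (P :|: (S :\: (m |: P))), m \notin P :|: (S :\: (m |: P)),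
      [disjoint P & S :\: (m |: P)]
    & #|S| = (#|P| + #|S :\: (m |: P)|).+1].
Proof.
move=> mS /fintype.subsetP PS.
have mP : m \notin P by apply/negP => /PS; rewrite !inE eqxx.
have PmS : m |: P \subset S.
  by apply/fintype.subsetP => x /setU1P[->//|/PS]; rewrite inE => /andP[].
split.
- apply/setP => x; have /implyP := fintype.subsetP PmS x; rewrite !inE.
  by case: (x == m); case: (x \in P); case: (x \in S).
- by rewrite !inE eqxx (negbTE mP).
- rewrite -setI_eq0; apply/eqP/setP => x; rewrite !inE negb_or.
  by case: (x \in P); rewrite ?andbF.
- by rewrite -(cardsID (m |: P) S) (finset.setIidPr PmS) cardsU1 mP add1n addSn.
Qed.

(** Applied to an eigenvalue equation with positive terms, this rules out neighbours beyond those
    that already account for the sum. *)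
Lemma sum_pos_subset (R : realType) (I : finType) (A : pred I) (B : {set I})
    (F : I -> R) : (forall i, i \in B -> A i) -> (forall i, A i -> 0 < F i) ->
  \sum_(i | A i) F i = \sum_(i in B) F i -> forall i, A i = (i \in B).
Proof.
move=> BA F0; rewrite (bigID (mem B)) /= => eqF i; apply/idP/idP => [Ai|/BA//].
apply/negPn/negP => iB; have : \sum_(j | A j && (j \notin B)) F j = 0.
  move: eqF; rewrite (eq_bigl (mem B)) => [|j]; first lra.
  by rewrite /= andbC; case: (boolP (j \in B)) => // /BA ->.
move/psumr_eq0P => /(_ _ i); rewrite Ai iB => F00.
by have := F0 i Ai; rewrite F00 ?ltxx // => j /andP[/F0/ltW].
Qed.

(** * The two comparisons *)

Section Comparison.
Variables (R : realType) (alpha : R) (G : sgraph) (u v : G).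
Hypothesis halpha : 0 <= alpha < 1.
Hypothesis uv : u != v.
Hypothesis indep : forall x y, x \in ~: [set u; v] -> y \in ~: [set u; v] -> ~~ adj x y.
Hypothesis cover : forall x, x \in ~: [set u; v] -> adj u x || adj v x.
Variables (s t : nat) (l x1 x2 z p q : R).
Hypothesis eig : G2_eigenvector alpha s t l x1 x2 z p q.
Hypothesis ts : (t <= s)%N.
Hypothesis card_rest : #|~: [set u; v]| = (s + t).+1.

Let alpha0 : 0 <= alpha. Proof. by case/andP: halpha. Qed.
Let beta0 : 0 < 1 - alpha. Proof. by rewrite subr_gt0; case/andP: halpha. Qed.
Let x21 : x2 <= x1. Proof. exact: G2_eigenvector_ge eig. Qed.

(** By [cover] at least one of the two edges is present, and the other contributes nothing
    negative. *)
Lemma adj_parent_ge a b x w : 0 < a -> 0 < b -> 0 < w -> x \in ~: [set u; v] ->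
  Num.min (edge_form alpha a w) (edge_form alpha b w) <=
  (if adj u x then edge_form alpha a w else 0)
  + (if adj v x then edge_form alpha b w else 0).
Proof.
move=> a0 b0 w0 /cover; rewrite ge_min.
have ea : 0 <= edge_form alpha a w by rewrite edge_form_ge0 // ltW.
have eb : 0 <= edge_form alpha b w by rewrite edge_form_ge0 // ltW.
by case: (adj u x); case: (adj v x) => // _; rewrite ?addr0 ?add0r ?lexx ?orbT ?lerDl ?eb.
Qed.

Lemma common_neighbor_compare m :
  adj u m -> adj v m -> m \in ~: [set u; v] ->
  (s < #|[set x in ~: [set u; v] | adj u x]|)%N ->
  l <= lambda_alpha alpha G
  /\ (lambda_alpha alpha G = l -> graph_isomorphic G (G2 s t)).
Proof.
move=> um vm mS; set L := [set x in _ | _] => sL.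
have mL : m \in L by rewrite inE mS.
(* The strict bound [sL] leaves $s$ neighbours of [u] after [m] is set aside. *)
have [P PL cardP] : exists2 P : {set G}, P \subset L :\ m & #|P| = s.
  by apply: subset_of_card; move: sL; rewrite (cardsD1 m) mL add1n ltnS.
have adjP x : x \in P -> adj u x.
  by move/(fintype.subsetP PL); rewrite !inE => /and3P[].
have PS : P \subset ~: [set u; v] :\ m.
  apply: fintype.subset_trans PL _; apply: finset.setSD.
  by apply/fintype.subsetP => x; rewrite inE => /andP[].
have [partS mPQ disPQ cardS] := complete_partition mS PS.
set Q := ~: [set u; v] :\: (m |: P) in partS mPQ disPQ cardS.
have cardQ : #|Q| = t.
  by move/eqP: cardS; rewrite card_rest cardP eqSS eqn_add2l => /eqP.
case: eig => x10 x20 z0 p0 q0 e1 e2 ez ep eq.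
have [|le_l eqA] := @test_compare R alpha G u v uv indep m P Q partS mPQ disPQ
  x1 x2 z p q l x10.
  rewrite um vm cardP cardQ -(G2_eigenvector_form eig) -!addrA.
  (* A possible edge $uv$ can only increase the form. *)
  apply: ler_wpDl.
    by case: adj => //; rewrite edge_form_ge0 // ltW.
  rewrite !lerD2l; apply: lerD.
    rewrite -cardP; apply: ler_sum_const => x xP; rewrite adjP // lerDl.
    by case: adj => //; rewrite edge_form_ge0 // ltW.
  rewrite -cardQ; apply: ler_sum_const => x xQ.
  apply: le_trans (adj_parent_ge x10 x20 q0 (Q_rest partS xQ)).
  by rewrite le_min lexx andbT edge_form_mono // ltW.
split=> // /eqA {}eqA.
have test_gt0 x : 0 < test_fun u v m P x1 x2 z p q x.
  by rewrite /test_fun; do 4 case: ifP => _ //.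
set y := test_fun _ _ _ _ _ _ _ _ _ in eqA test_gt0.
have yu : y u = x1 by rewrite /y test_u.
have yv : y v = x2 by rewrite /y test_v.
have ym : y m = z by rewrite /y (test_m partS).
have yP x : x \in P -> y x = p by move=> xP; rewrite /y (test_P partS mPQ).
have yQ x : x \in Q -> y x = q by move=> xQ; rewrite /y (test_Q partS mPQ disPQ).
have mP : m \notin P by move: mPQ; rewrite inE negb_or => /andP[].
have mQ : m \notin Q by move: mPQ; rewrite inE negb_or => /andP[].
have term0 x w : 0 < alpha * y x + (1 - alpha) * y w.
  by rewrite ltr_wpDl ?mulr_gt0 ?mulr_ge0 // ltW.
(* The equation at [u] has the same value as the one at $v_1$ in the tree, and [m] with [P] already
   exhausts it. *)
have adju x : adj u x = (x \in m |: P).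
  move: x; apply: sum_pos_subset (fun w _ => term0 u w) _.
    by move=> x /setU1P[->|/adjP].
  rewrite -/(Aop alpha y u) eqA yu big_setU1 //= ym -e1; congr (_ + _).
  rewrite mulr_natl -cardP -sumr_const; apply: eq_bigr => x xP; by rewrite yP.
have adjv x : adj v x = (x \in m |: Q).
  move: x; apply: sum_pos_subset (fun w _ => term0 v w) _.
    move=> x /setU1P[->//|xQ]; have := cover (Q_rest partS xQ).
    by rewrite adju !inE (disjointFl disPQ xQ); case: eqVneq => [->|].
  rewrite -/(Aop alpha y v) eqA yv big_setU1 //= ym -e2; congr (_ + _).
  rewrite mulr_natl -cardQ -sumr_const; apply: eq_bigr => x xQ; by rewrite yQ.
by rewrite -cardP -cardQ; apply: isomorphic_G2 adju adjv.
Qed.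

(** The smallest of $x_1,x_2,z$ goes to a leaf [m] and the larger two to the centres, the largest to
    [u]. The bounds on the number of leaves at [v] supply enough leaves at [u]. *)
Lemma double_star_compare : (0 < t)%N -> adj u v ->
  (forall x, x \in ~: [set u; v] -> adj v x = ~~ adj u x) ->
  (0 < #|[set x in ~: [set u; v] | adj v x]| <= minn s t.+1)%N ->
  l < lambda_alpha alpha G.
Proof.
move=> t0 auv adjv; set L := [set x in _ | _]; rewrite leq_min.
case/and3P=> L0 Ls Lt.
case: (eig) => x10 x20 z0 p0 q0 e1 e2 ez ep eq.
have tR : 0 < t%:R :> R by rewrite ltr0n.
(* [x2] and [z] cannot satisfy the eigenvalue equation of a leaf attached to
   [z] or [x2]. *)
have x2_leaf : alpha * x2 + (1 - alpha) * z = l * x2 -> False.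
  move=> h; have : t%:R * (alpha * x2 + (1 - alpha) * q) = 0 by lra.
  by apply/eqP; rewrite gt_eqF // mulr_gt0 // ltr_wpDl ?mulr_gt0 ?mulr_ge0 // ltW.
have z_leaf : alpha * z + (1 - alpha) * x2 = l * z -> False.
  move=> h; have : alpha * z + (1 - alpha) * x1 = 0 by lra.
  by apply/eqP; rewrite gt_eqF // ltr_wpDl ?mulr_gt0 ?mulr_ge0 // ltW.
have form := G2_eigenvector_form eig.
have nbr m : m \in ~: [set u; v] ->
    forall x, adj m x = (x == if adj v m then v else u).
  move=> mS x; rewrite adj_sym.
  case: (eqVneq x u) => [->|xu].
    by have := adjv m mS; case: (adj u m) => ->; rewrite ?eqxx // (negbTE uv).
  case: (eqVneq x v) => [->|xv].
    by case: (adj v m); rewrite ?eqxx // eq_sym (negbTE uv).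
  rewrite (negbTE (indep _ mS)); last by rewrite !inE negb_or xu.
  by case: (adj v m); apply/esym/negbTE.
(* The frame common to the three orders: [w] is the neighbour of [m] and [d] its value. The edges
   $uv$ and $mw$ are compared with the path of the tree, the others with its pendant edges. *)
have strict m (P Q : {set G}) (a b c p' q' : R) w d : ~: [set u; v] = m |: (P :|: Q) ->
    m \notin P :|: Q -> [disjoint P & Q] -> #|P| = s -> #|Q| = t -> 0 < a ->
    w = (if adj v m then v else u) -> d = (if adj v m then b else a) ->
    (alpha * c + (1 - alpha) * d = l * c -> False) ->
    l * (a ^+ 2 + b ^+ 2 + c ^+ 2 + s%:R * p' ^+ 2 + t%:R * q' ^+ 2) <=
      edge_form alpha a b + edge_form alpha c d
      + (s%:R * edge_form alpha x1 p + t%:R * edge_form alpha x2 q) ->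
    (forall x, x \in P -> edge_form alpha x1 p <=
      (if adj u x then edge_form alpha a p' else 0)
      + (if adj v x then edge_form alpha b p' else 0)) ->
    (forall x, x \in Q -> edge_form alpha x2 q <=
      (if adj u x then edge_form alpha a q' else 0)
      + (if adj v x then edge_form alpha b q' else 0)) ->
    l < lambda_alpha alpha G.
  move=> partS mPQ disPQ cP cQ a0 wE dE nleaf le_form leP leQ.
  have mS := m_rest partS.
  have [|le_l eqA] := @test_compare R alpha G u v uv indep m P Q partS mPQ disPQ
    a b c p' q' l a0.
    rewrite cP cQ; apply: le_trans le_form _.
    rewrite -[X in _ <= X]addrA; apply: lerD; last first.
      by rewrite -cP -cQ; apply: lerD; apply: ler_sum_const.
    rewrite auv lerD2l dE adjv //.
    by case: (adj u m); rewrite /= ?addr0 ?add0r edge_formC.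
  rewrite lt_neqAle le_l andbT; apply/eqP => /esym/eqA/(_ m).
  rewrite /Aop (big_pred1 w) => [|x]; last by rewrite nbr // wE.
  rewrite (test_m partS) => h; apply: nleaf; rewrite -h; congr (_ + _ * _).
  by rewrite wE dE; case: (adj v m); rewrite ?test_u ?test_v.
(* First the order $x_2\le x_1\le z$: [m] is a leaf at [u] with value $x_2$. As [v] has at most $s$
   leaves, [u] has at least $t+1$, which provide [m] and [Q]. *)
case: (leP x1 z) => [zx1|zx1].
  have LS : L \subset ~: [set u; v].
    by apply/fintype.subsetP => x; rewrite inE => /andP[].
  pose L' := ~: [set u; v] :\: L.
  have cL' : #|L'| = ((s + t).+1 - #|L|)%N.
    by rewrite cardsD card_rest (finset.setIidPr LS).
  have [m mL'] : exists m, m \in L' by apply/card_gt0P; rewrite cL'; clear -Ls; lia.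
  have [Q QL' cQ] : exists2 Q : {set G}, Q \subset L' :\ m & #|Q| = t.
    by apply: subset_of_card; have := cardsD1 m L'; rewrite mL' cL'; clear -Ls; lia.
  have L'P x : x \in L' -> (x \in ~: [set u; v]) /\ adj v x = false.
    by rewrite [x \in L']inE => /andP[+ xS]; rewrite inE xS => /negbTE.
  have [mS vm] := L'P m mL'.
  have QS : Q \subset ~: [set u; v] :\ m.
    apply: fintype.subset_trans QL' _; apply: finset.setSD.
    by apply/fintype.subsetP => x /L'P[].
  have [partS mPQ disPQ cardS] := complete_partition mS QS.
  set P := ~: [set u; v] :\: (m |: Q) in partS mPQ disPQ cardS.
  rewrite (finset.setUC Q) in partS mPQ; rewrite disjoint_sym in disPQ.
  apply: (strict m P Q z x1 x2 p q u z) => //; rewrite ?vm //.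
  - by move/eqP: cardS; rewrite card_rest cQ eqSS addnC eqn_add2l => /eqP.
  - rewrite [z ^+ 2 + _]addrC [_ + z ^+ 2 + _]addrAC -form (edge_formC _ z x1).
    by rewrite [X in _ <= X]addrA.
  - move=> x xP; apply: le_trans (adj_parent_ge z0 x10 p0 (P_rest partS xP)).
    by rewrite le_min lexx andbT edge_form_mono // ltW.
  - move=> x /(fintype.subsetP QL'); rewrite in_setD1 => /andP[_ /L'P[xS vx]].
    have ux : adj u x by apply: negbFE; rewrite -adjv.
    by rewrite ux vx addr0 edge_form_mono // ?(ltW q0) ?(ltW x20) // (le_trans x21).
(* Now $z<x_1$, and [m] is a leaf at [v]. As [v] has at most $t+1$ leaves, [u] has at least $s$,
   which provide [P]. *)
set Lc := [set x in ~: [set u; v] | adj u x].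
have cLc : (#|L| + #|Lc| = (s + t).+1)%N.
  rewrite -card_rest -(cardsID L (~: [set u; v])); congr (_ + _)%N; apply: eq_card => x.
    by rewrite !inE; case: (adj v x); rewrite ?andbT ?andbF ?andbb.
  rewrite [RHS]inE [x \in Lc]inE [x \in L]inE.
  case: (boolP (x \in ~: [set u; v])) => xS; last by rewrite andbF.
  by rewrite adjv // negbK andbT.
have [m mL] : exists m, m \in L by apply/card_gt0P.
have /setIdP[mS vm] := mL.
have [P PLc cP] : exists2 P : {set G}, P \subset Lc & #|P| = s.
  by apply: subset_of_card; clear -cLc Lt; lia.
have PS : P \subset ~: [set u; v] :\ m.
  apply/fintype.subsetP => x /(fintype.subsetP PLc) /setIdP[xS ux].
  rewrite in_setD1 xS andbT; apply: contraTneq ux => ->.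
  by have := adjv m mS; rewrite vm => /esym.
have [partS mPQ disPQ cardS] := complete_partition mS PS.
set Q := ~: [set u; v] :\: (m |: P) in partS mPQ disPQ cardS.
have cQ : #|Q| = t.
  by move/eqP: cardS; rewrite card_rest cP eqSS eqn_add2l => /eqP.
have boundP x : x \in P -> forall b, edge_form alpha x1 p <=
    (if adj u x then edge_form alpha x1 p else 0)
    + (if adj v x then edge_form alpha b p else 0).
  move=> /(fintype.subsetP PLc) /setIdP[xS ux] b.
  by rewrite adjv // ux addr0.
have boundQ x b : x2 <= b -> x \in Q -> edge_form alpha x2 q <=
    (if adj u x then edge_form alpha x1 q else 0)
    + (if adj v x then edge_form alpha b q else 0).
  move=> x2b xQ; apply: le_trans (adj_parent_ge x10 _ q0 (Q_rest partS xQ)).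
    by rewrite le_min !edge_form_mono // ltW.
  exact: lt_le_trans x2b.
(* If $z\le x_2$, then [v] gets $x_2$ and [m] gets $z$; the edge $uv$ replaces $v_1v_3$ and
   gains. *)
case: (leP z x2) => [zx2|x2z].
  apply: (strict m P Q x1 x2 z p q v x2) => //; rewrite ?vm //.
  - rewrite -form (edge_formC _ z x2) [X in _ <= X]addrA !lerD2r.
    rewrite (edge_formC _ x1 x2) (edge_formC _ x1 z).
    by rewrite edge_form_mono // ltW.
  - by move=> x xP; apply: boundP.
  - by move=> x; apply: boundQ.
(* If $x_2<z<x_1$, the edges $uv$ and $vm$ carry exactly the values of $v_1v_3$ and $v_3v_2$. *)
apply: (strict m P Q x1 z x2 p q v z) => //; rewrite ?vm //.
- by rewrite [x1 ^+ 2 + z ^+ 2 + _]addrAC -form [X in _ <= X]addrA.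
- by move=> x xP; apply: boundP.
- by move=> x; apply: boundQ; apply: ltW.
Qed.

End Comparison.

(** * Graphs with independence number [n - 2] *)

Lemma connected_nbr (G : sgraph) (x y : G) :
  graph_connected G -> x != y -> exists w, adj x w.
Proof.
move=> [_ con] xy; have /connectP[[|w p] /= pth e] := con x y.
  by rewrite e eqxx in xy.
by exists w; case/andP: pth.
Qed.

Lemma independence_number_attained (G : sgraph) :
  exists2 S : {set G}, independent S & #|S| = independence_number G.
Proof.
have [|S indS maxS] := @eq_bigmax_cond _ (@independent G) (fun S => #|S|).
  by apply/card_gt0P; exists finset.set0; apply/forall_inP => x; rewrite inE.
by exists S => //; apply: esym; exact: maxS.
Qed.

Lemma independent_leq (G : sgraph) (S : {set G}) :
  independent S -> (#|S| <= independence_number G)%N.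
Proof. exact: (@leq_bigmax_cond _ (@independent G) (fun S => #|S|)). Qed.

Lemma independentP (G : sgraph) (S : {set G}) :
  reflect (forall x y, x \in S -> y \in S -> ~~ adj x y) (independent S).
Proof.
apply: (iffP forall_inP) => [h x y xS yS|h x xS].
  exact: (forall_inP (h x xS)) y yS.
by apply/forall_inP => y; apply: h.
Qed.

(** The vertices [u] and [v] left out by a maximum independent set either share a neighbour in it or
    are the centres of a double star; balance, $s\le t+1$, makes the counts of both comparisons
    work. *)
Lemma G2_minimal (R : realType) (alpha : R) (G : sgraph) s t l x1 x2 z p q :
  0 <= alpha < 1 -> graph_connected G -> graph_order G = (s + t + 3)%N ->
  independence_number G = (s + t).+1 -> (0 < t <= s)%N -> (s <= t.+1)%N ->
  G2_eigenvector alpha s t l x1 x2 z p q ->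
  l <= lambda_alpha alpha G
  /\ (lambda_alpha alpha G = l -> graph_isomorphic G (G2 s t)).
Proof.
move=> halpha con ordG indG /andP[t0 ts] st eig.
have [S /independentP indS cardS] := independence_number_attained G.
have [u [v uv SE]] : exists u, exists2 v, u != v & ~: S = [set u; v].
  suff /cards2P[u [v [uv Suv]]] : #|~: S| == 2%N by exists u, v.
  have := cardsC S; rewrite cardS indG.
  rewrite -[#|G|]/(graph_order G) ordG; clear; lia.
have {}SE : S = ~: [set u; v] by rewrite -SE finset.setCK.
have cover x : x \in S -> adj u x || adj v x.
  move=> xS; have xu : x != u.
    by move: xS; rewrite SE !inE negb_or => /andP[].
  have [w xw] := connected_nbr con xu.
  have : w \notin S by apply: contraTN xw => wS; apply: indS.
  by rewrite SE inE negbK !inE ![adj _ x]adj_sym => /orP[] /eqP<-; rewrite xw ?orbT.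
rewrite {}SE in cardS indS cover; rewrite indG in cardS.
set Nu := [set x in ~: [set u; v] | adj u x].
set Nv := [set x in ~: [set u; v] | adj v x].
have sum_N : (#|Nu| + #|Nv| = (s + t).+1 + #|Nu :&: Nv|)%N.
  rewrite -cardsUI; congr (_ + _)%N; rewrite -cardS; apply: eq_card => x.
  rewrite [LHS]inE [x \in Nu]inE [x \in Nv]inE.
  by case: (boolP (x \in ~: [set u; v])) => //= /cover.
wlog le_N : u v uv cover indS cardS @Nu @Nv sum_N / (#|Nv| <= #|Nu|)%N.
  move=> W; case/orP: (leq_total #|Nv| #|Nu|) => le_N; first exact: (W u v).
  apply: (W v u); rewrite ?[_ == u]eq_sym ?(finset.setUC [set v]) //.
  - by move=> x /cover; rewrite orbC.
  - by rewrite addnC (finset.setIC [set _ in _ | _]).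
have [m /setIP[/setIdP[mS um] /setIdP[_ vm]]|no_common] := pickP (mem (Nu :&: Nv)).
  apply: (common_neighbor_compare halpha uv indS cover eig ts cardS um vm mS).
  (* Here $2|N_u|\ge s+t+2\ge 2s+1$, hence $|N_u|>s$. *)
  have : (0 < #|Nu :&: Nv|)%N.
    by apply/card_gt0P; exists m; apply/setIP; split; rewrite inE mS.
  by move: sum_N le_N st; rewrite -/Nu; clear; lia.
have N0 : #|Nu :&: Nv| = 0%N by apply: eq_card0.
rewrite N0 addn0 in sum_N.
have adjv x : x \in ~: [set u; v] -> adj v x = ~~ adj u x.
  move=> xS; have : x \notin Nu :&: Nv := negbT (no_common x).
  rewrite finset.in_setI [x \in Nu]inE [x \in Nv]inE xS /=; have := cover x xS.
  by case: (adj u x); case: (adj v x).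
have restE x : (x \in ~: [set u; v]) = (x != u) && (x != v).
  by rewrite !inE negb_or.
(* Otherwise [u] with its neighbours would be closed under adjacency and would miss [v]. *)
have auv : adj u v.
  apply/negPn/negP => nuv.
  have closedNu : closed (@adj G) (mem (u |: Nu)).
    apply: (intro_closed (sym_connect_sym (@adj_sym G))) => x y xy.
    move/setU1P => [xu|/setIdP[xS ux]].
      rewrite xu in xy; apply/setU1P; right; rewrite inE xy andbT restE.
      by apply/andP; split; apply: contraTneq xy => ->; rewrite ?adj_irr.
    apply/setU1P; left; apply/eqP/negPn/negP => yu.
    have [yv|yv] := eqVneq y v.
      by move: (adjv x xS); rewrite ux -yv adj_sym xy.
    by move: xy; apply/negP/indS; rewrite // restE yu.
  have : v \in u |: Nu.
    have /= <- := closed_connect closedNu (con.2 u v).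
    exact: finset.setU11.
  rewrite in_setU1 eq_sym (negbTE uv) => /setIdP[].
  by rewrite restE eqxx andbF.
suff lt_l : l < lambda_alpha alpha G.
  by split=> [|ll]; [apply: ltW | move: lt_l; rewrite ll ltxx].
apply: (double_star_compare halpha uv indS cover eig ts cardS t0 auv adjv).
(* The upper bound comes from $2|N_v|\le s+t+1$ with $t\le s\le t+1$. *)
rewrite -/Nv leq_min; apply/andP; split; last first.
  by move: sum_N le_N st ts; clear; lia.
(* If [v] had no leaf, it could be added to the independent set, against maximality. *)
rewrite lt0n; apply/negP => /eqP Nv0.
have : independent (v |: ~: [set u; v]).
  have vS x : x \in ~: [set u; v] -> adj v x = false.
    move=> xS; apply/negP => vx; have : x \in Nv by rewrite inE xS.
    by rewrite (cards0_eq Nv0) inE.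
  apply/independentP => x y /setU1P[->|xS] /setU1P[->|yS].
  - by rewrite adj_irr.
  - by rewrite vS.
  - by rewrite adj_sym vS.
  - exact: indS.
by move/independent_leq; rewrite indG cardsU1 restE eqxx andbF cardS ltnn.
Qed.

Theorem theorem1p2 (R : realType) (n : nat) (alpha : R) (G : sgraph)
    (hn : (5 <= n)%N) (halpha : 0 <= alpha < 1)
    (hconn : graph_connected G) (hord : graph_order G = n)
    (hind : independence_number G = (n - 2)%N) :
  lambda_alpha alpha (G2 (uphalf (n - 3)) (n - 3)./2) <= lambda_alpha alpha G
  /\ (lambda_alpha alpha G
        = lambda_alpha alpha (G2 (uphalf (n - 3)) (n - 3)./2)
      <-> graph_isomorphic G (G2 (uphalf (n - 3)) (n - 3)./2)).
Proof.
have st : (uphalf (n - 3) + (n - 3)./2 = n - 3)%N.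
  by rewrite uphalf_half -addnA addnn odd_double_half.
(* From $n\ge 5$, each side of the tree has a leaf. *)
have t0 : (0 < (n - 3)./2 <= uphalf (n - 3))%N.
  by rewrite half_gt0 uphalf_half leq_addl andbT; clear -hn; lia.
have s1 : (uphalf (n - 3) <= (n - 3)./2.+1)%N.
  by rewrite uphalf_half; case: odd; rewrite ?add0n ?add1n.
have [x1 [x2 [z [p [q eig]]]]] :=
  G2_eigenvector_exists halpha (uphalf (n - 3)) (proj1 (andP t0)).
have [| |le_l iso] := G2_minimal halpha hconn _ _ t0 s1 eig.
- by rewrite hord st; clear -hn; lia.
- by rewrite hind st; clear -hn; lia.
split=> //; split=> // GH; exact: lambda_alpha_isomorphic.
Qed.
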